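(* Let $\lambda=(\lambda_1,\dots,\lambda_l)$ be a partition of length $l$, $\tau(t)=s_\lambda(t)+\sum_{\lambda<\mu}\xi_\mu s_\mu(t)$ with $\xi_\mu\in\mathbb C$, and $0\le k\le l$. Then $$\partial_1^{N_{\lambda,k}}\tau\Big(\sum_{i=1}^k[x_i]\Big)=c'_{\lambda,k}\,\tau^{(k)}\Big(\sum_{i=1}^k[x_i]\Big),\qquad c'_{\lambda,k}=\frac{N_{\lambda,k}!}{\prod_{i=1}^{l-k}w_i!}\prod_{1\le i<j\le l-k}(w_j-w_i).$$
   Context: For $t=(t_1,t_2,\dots)$ define $p_m(t)$ by $\exp(\sum_{m\ge1}t_mk^m)=\sum_{m\ge0}p_m(t)k^m$, $p_m=0$ for $m<0$; $s_\mu(t)=\det(p_{\mu_i-i+j}(t))_{1\le i,j\le l}$. $[x]=(x,x^2/2,\dots)$, $\partial_1=\partial/\partial t_1$. $\lambda<\mu$ means $\lambda_i\le\mu_i$ for all $i$ and $\lambda\ne\mu$. $\tau$ is a formal series, differentiated termwise, evaluations being formal power series in the $x_i$. $N_{\lambda,k}=\lambda_{k+1}+\dots+\lambda_l$; $(w_l,\dots,w_1)=(\lambda_1,\dots,\lambda_l)+(l-1,\dots,1,0)$. For $1\le k\le l$, $\tau^{(k)}(t)=s_{(\lambda_1,\dots,\lambda_k)}(t)+\sum_\mu\xi_\mu s_{(\mu_1,\dots,\mu_k)}(t)$ summed over partitions $\mu=(\mu_1,\dots,\mu_l)$ with $\lambda<\mu$ and $\mu_i=\lambda_i$ for $k+1\le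 i\le l$; $\tau^{(0)}=1$. For $k=0$ evaluation is at $t=0$. *)

(* Defs.v *)
From HB Require Import structures.
From mathcomp Require Import all_boot all_order all_algebra.
From mathcomp Require Import mpoly.
Set Implicit Arguments. Unset Strict Implicit. Unset Printing Implicit Defensive.
Import Order.TTheory GRing.Theory Num.Theory.
Local Open Scope ring_scope.

Definition is_part (s : seq nat) : bool := sorted geq s && (0%N \notin s).

Definition part_leq (lam mu : seq nat) : bool :=
  all (fun i => nth 0%N lam i <= nth 0%N mu i)%N (iota 0 (size lam)).
Definition part_lt (lam mu : seq nat) : bool := part_leq lam mu && (lam != mu).

(* Every partition of size <= D is encoded uniquely by a nonincreasing
   f : 'I_D -> 'I_D.+1 (its parts padded with zeros). *)
Definition part_of_ffun D (f : {ffun 'I_D -> 'I_D.+1}) : seq nat :=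
  [seq val (f i) | i <- enum 'I_D & (0 < f i)%N].
Definition ffun_noninc D (f : {ffun 'I_D -> 'I_D.+1}) : bool :=
  [forall i : 'I_D, forall j : 'I_D, (i <= j)%N ==> (f j <= f i)%N].

Definition sum_parts_upto (V : nmodType) (D : nat) (F : seq nat -> V) : V :=
  \sum_(f : {ffun 'I_D -> 'I_D.+1} |
        ffun_noninc f && (sumn (part_of_ffun f) <= D)%N) F (part_of_ffun f).

Section Schur.
Variable C : numClosedFieldType.
Variable A : lalgType C.

(* p_m(t) = coefficient of k^m in exp(sum_j t_j k^j) = sum_r (1/r!) [k^m] f^r,
   f = sum_j t_j k^j; since f has no constant term, only j <= m and
   powers r <= m contribute. *)
Definition pfun (t : nat -> A) (m : nat) : A :=
  let f : {poly A} := \sum_(1 <= j < m.+1) t j *: 'X^j in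
  \sum_(r < m.+1) (r`!%:R^-1 : C) *: (f ^+ r)`_m.

Definition pfunz (t : nat -> A) (z : int) : A :=
  if (z < 0)%R then 0 else pfun t `|z|%N.

End Schur.

(* Schur function s_mu(t) as a polynomial in the variables t_1..t_n,
   n = (mu_1 + l(mu)).+1, which contains all t_j it depends on
   (entries p_{mu_i - i + j} only involve t_1 .. t_{mu_1 + l - 1}). *)
Definition nvars (mu : seq nat) : nat := (head 0%N mu + size mu).+1.

Definition tvar (C : numClosedFieldType) (n : nat) (j : nat) : {mpoly C[n.+1]} :=
  if (0 < j <= n.+1)%N then 'X_(inord j.-1) else 0.

Definition schur_t (C : numClosedFieldType) (mu : seq nat)
  : {mpoly C[nvars mu]} :=
  \det (\matrix_(i < size mu, j < size mu)
          pfunz (tvar C (head 0%N mu + size mu))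
                ((nth 0%N mu i)%:Z + j%:Z - i%:Z)).

Definition d1 (C : numClosedFieldType) (mu : seq nat) (p : {mpoly C[nvars mu]})
  : {mpoly C[nvars mu]} := mderiv (ord0 : 'I_(nvars mu)) p.

Definition powsum (C : numClosedFieldType) (k j : nat) : {mpoly C[k]} :=
  \sum_(i < k) (j%:R^-1 : C) *: 'X_i ^+ j.

Definition eval_x (C : numClosedFieldType) (k n : nat) (p : {mpoly C[n]})
  : {mpoly C[k]} :=
  p \mPo [tuple powsum C k i.+1 | i < n].

(* ---------- formal series sum_mu c_mu G_mu in x_1..x_k ----------
   Each G_mu used below is homogeneous of degree |mu| - N, so the family is
   summable; the coefficient of a monomial m is the finite sum over the mu
   with |mu| <= deg m + N (all other terms have zero m-coefficient). *)
Definition fps_coef (C : numClosedFieldType) (k N : nat)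
  (c : seq nat -> C) (G : seq nat -> {mpoly C[k]}) (m : 'X_{1..k}) : C :=
  sum_parts_upto (mdeg m + N) (fun mu => c mu * (G mu)@_m).

Definition tau_coef (C : numClosedFieldType) (lam : seq nat) (xi : seq nat -> C)
  (mu : seq nat) : C :=
  if mu == lam then 1 else if part_lt lam mu then xi mu else 0.

(* coefficients of tau^(k) = s_(lam_1..lam_k) + sum_mu xi_mu s_(mu_1..mu_k),
   mu = (mu_1..mu_l) partitions with lam < mu and mu_i = lam_i for k < i <= l;
   the term for mu is s_{take k mu}. *)
Definition tauk_coef (C : numClosedFieldType) (lam : seq nat) (xi : seq nat -> C)
  (k : nat) (mu : seq nat) : C :=
  if mu == lam then 1
  else if [&& part_lt lam mu, size mu == size lam & drop k mu == drop k lam]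
       then xi mu else 0.

Definition Nlk (lam : seq nat) (k : nat) : nat := sumn (drop k lam).

(* (w_l,...,w_1) = (lam_1,...,lam_l) + (l-1,...,0): w_i = lam_{l+1-i} + i - 1 *)
Definition wi (lam : seq nat) (i : nat) : nat :=
  (nth 0%N lam (size lam - i) + i.-1)%N.

Definition cprime (C : numClosedFieldType) (lam : seq nat) (k : nat) : C :=
  let L := (size lam - k)%N in
  ((Nlk lam k)`!%:R / \prod_(i < L) ((wi lam i.+1)`!)%:R)
  * \prod_(i < L) \prod_(j < L | (i < j)%N)
        ((wi lam j.+1)%:R - (wi lam i.+1)%:R).

(* Main.v *)
Require Import Defs.
From HB Require Import structures.
From mathcomp Require Import all_boot all_order all_algebra.
From mathcomp Require Import perm mpoly zify.
Set Implicit Arguments. Unset Strict Implicit. Unset Printing Implicit Defensive.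
Import Order.TTheory GRing.Theory Num.Theory.
Local Open Scope ring_scope.

(* The identity holds for each [mu] separately.  By Taylor's formula
   [d_1^N s_mu] at [sum_i [x_i]] is [N!] times the coefficient of [z^N] in
   [s_mu (sum_i [x_i] + (z, 0, 0, ...))], a determinant [det q_(mu_i - i + j)]
   where [sum_m q_m u^m = exp (z u) / prod_(i <= k) (1 - x_i u)].  Column
   operations by the coefficients of [prod_(i <= k) (1 - x_i u)] turn [q_m] into
   [z^m / m!] in all columns but the first [k].  The lowest-order term in [z] of
   the new determinant has degree [mu_(k+1) + mu_(k+2) + ... >= N] and is the
   product of [s_(mu_1, ..., mu_k)] at [sum_i [x_i]] and
   [det (1 / (mu_i - i + j)!)_(i, j > k)]; the latter is a Vandermonde
   determinant divided by factorials. *)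

(** * Generating series of the complete functions *)

Section PfunRecursion.
Variables (C : numClosedFieldType) (A : comAlgType C) (t : nat -> A).

Let f (M : nat) : {poly A} := \sum_(1 <= j < M.+1) t j *: 'X^j.

Let coef_f M i : (f M)`_i = if (0 < i <= M)%N then t i else 0.
Proof.
rewrite /f coef_sum; case: ifP => [iM|niM].
  rewrite (bigD1_seq i) ?iota_uniq ?mem_index_iota //= coefZ coefXn eqxx mulr1.
  rewrite big1 ?addr0 // => j ji.
  by rewrite coefZ coefXn eq_sym (negbTE ji) mulr0.
rewrite big_nat big1 // => j jM; rewrite coefZ coefXn.
have /negbTE-> : i != j by apply: contraFneq niM => ->; rewrite -ltnS.
by rewrite mulr0.
Qed.

(** A coefficient of degree [i] of a power of [f] only involves [t_1, ..., t_i], so any truncation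
    order at least [i] gives the same value. *)
Let coef_f_exp_trunc M M' r i : (i <= M)%N -> (i <= M')%N ->
  (f M ^+ r)`_i = (f M' ^+ r)`_i.
Proof.
elim: r i => [|r IHr] i iM iM'; first by rewrite !expr0.
rewrite !exprS !coefM; apply: eq_bigr => -[j /=]; rewrite ltnS => ji _.
rewrite !coef_f !(leq_trans ji) // (IHr (i - j)%N) //.
  exact: leq_trans (leq_subr _ _) iM.
exact: leq_trans (leq_subr _ _) iM'.
Qed.

Let coef_f_exp_lt M r i : (i < r)%N -> (f M ^+ r)`_i = 0.
Proof.
elim: r i => [|r IHr] i // ir; rewrite exprS coefM big1 // => -[[|j] /= ji] _.
  by rewrite coef_f mul0r.
rewrite IHr ?mulr0 // (leq_trans _ (_ : i <= r)%N) //.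
by rewrite ltn_subrL /=; case: (i) ji.
Qed.

(** A common truncation order, so that the recursion below can treat [p_0, ..., p_M] inside one
    exponential; powers above [m] contribute nothing because [f] has no constant term. *)
Let pfunE M m : (m <= M)%N ->
  pfun t m = \sum_(r < M.+1) (r`!%:R^-1 : C) *: (f M ^+ r)`_m.
Proof.
move=> mM; rewrite /pfun -/(f m).
rewrite (big_ord_widen M.+1 (fun r => (r`!%:R^-1 : C) *: (f m ^+ r)`_m)) //.
rewrite big_mkcond /=; apply: eq_bigr => r _; rewrite ltnS; case: leqP => rm.
  by rewrite (coef_f_exp_trunc r (leqnn m) mM).
by rewrite coef_f_exp_lt ?scaler0.
Qed.

Lemma pfun0 : pfun t 0 = 1.
Proof.
by rewrite /pfun big_ord1 fact0 invr1 scale1r expr0 coef1.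
Qed.

(* The coefficientwise form of P' = f' P for P = exp f. *)
Lemma pfun_rec m :
  pfun t m.+1 *+ m.+1 =
  \sum_(j < m.+1) (t j.+1 *+ j.+1) * pfun t (m - j).
Proof.
rewrite (@pfunE m.+1) // -sumrMnl big_ord_recl /= expr0 coef1 /= scaler0 mul0rn.
(* The derivative of [f^r / r!] is [f' f^(r-1) / (r-1)!]; the term [r = 0] has dropped out, so the
   index is shifted by one. *)
rewrite add0r; transitivity (\sum_(r < m.+1) (r`!%:R^-1 : C) *:
    \sum_(j < m.+1) (t j.+1 *+ j.+1) * (f m.+1 ^+ r)`_(m - j)).
  apply: eq_bigr => r _; rewrite /bump add1n scalerMnr -coef_deriv deriv_exp /=.
  rewrite coefMn -scaler_nat scalerA factS natrM invfM mulrAC mulVf ?pnatr_eq0 //.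
  rewrite mul1r coefM; congr (_ *: _); apply: eq_bigr => j _.
  by rewrite coef_deriv coef_f /= ltn_ord.
under [LHS]eq_bigr do rewrite scaler_sumr.
rewrite exchange_big /=; apply: eq_bigr => -[j /=]; rewrite ltnS => jm _.
rewrite (@pfunE m) ?leq_subr // mulr_sumr; apply: eq_bigr => r _.
rewrite scalerAr (@coef_f_exp_trunc m m.+1) ?leq_subr //.
exact: leq_trans (leq_subr _ _) (leqnSn _).
Qed.

End PfunRecursion.

(** * Removing factors [1 / (1 - x u)] through logarithmic derivatives *)

Section EliminateVariables.
Variable A : comNzRingType.
Implicit Types (a b : nat -> A) (Q : {poly A}).

Lemma coef0_prod_1sub k (x : 'I_k -> A) :
  (\prod_(i < k) (1 - x i *: 'X))`_0 = 1.
Proof.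
rewrite -horner_coef0 horner_prod big1 // => i _.
by rewrite hornerD hornerN hornerZ hornerX mulr0 subr0 -polyC1 hornerC.
Qed.

Lemma size_prod_1sub k (x : 'I_k -> A) :
  (size (\prod_(i < k) (1 - x i *: 'X))%R <= k.+1)%N.
Proof.
elim: k x => [|k IHk] x; first by rewrite big_ord0 size_poly1.
rewrite big_ord_recl (leq_trans (size_polyMleq _ _)) // -subn1 leq_subLR.
rewrite -[(1 + _)%N]/(2 + k.+1)%N leq_add ?IHk // (leq_trans (size_polyD _ _)) //.
rewrite size_poly1 size_polyN geq_max /= (leq_trans (size_scale_leq _ _)) //.
by rewrite size_polyX.
Qed.

(* [Q] solves [Q' = a Q] up to the order [M]. *)
Definition log_deriv (M : nat) a Q :=
  forall m, (m < M)%N -> Q`_m.+1 *+ m.+1 = \sum_(j < m.+1) a j * Q`_(m - j).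

(** The logarithmic derivative of [1 - x u] is minus the sum of the [x^(j+1) u^j], which cancels the
    extra term. *)
Lemma log_deriv_mul M b x Q :
  log_deriv M (fun j => b j + x ^+ j.+1) Q ->
  log_deriv M b ((1 - x *: 'X) * Q).
Proof.
move=> HQ m mM; set P := (_ * Q).
have P0 : P`_0 = Q`_0 by rewrite /P mulrBl mul1r -scalerAl coefB coefZ coefXM mulr0 subr0.
have PS i : P`_i.+1 = Q`_i.+1 - x * Q`_i.
  by rewrite /P mulrBl mul1r -scalerAl coefB coefZ coefXM.
(* Multiplication by [x / (1 - x u)], the sum of the [x^(j+1) u^j], undoes the factor [1 - x u]. *)
have tel i : \sum_(j < i.+1) x ^+ j.+1 * P`_(i - j) = x * Q`_i.
  elim: i => [|i IHi]; first by rewrite big_ord1 P0 expr1.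
  rewrite big_ord_recl /= subn0 expr1 PS.
  under eq_bigr do rewrite /bump add1n subSS exprS -mulrA.
  by rewrite -mulr_sumr IHi mulrBr subrK.
(* This is the coefficient of [u^m] in [(1 - x u) Q']. *)
have conv : \sum_(j < m.+1) (b j + x ^+ j.+1) * P`_(m - j) =
    Q`_m.+1 *+ m.+1 - x * (Q`_m *+ m).
  rewrite HQ // big_ord_recr [X in _ = X - _]big_ord_recr /= subnn P0.
  rewrite addrAC; congr (_ + _).
  case: m mM => [|m] mM; first by rewrite !big_ord0 mulr0n mulr0 subrr.
  rewrite (HQ m (ltnW mM)) mulr_sumr -sumrB; apply: eq_bigr => -[j /=].
  rewrite ltnS => jm _; rewrite subSn // PS mulrBr; congr (_ - _).
  by rewrite mulrCA.
have -> : \sum_(j < m.+1) b j * P`_(m - j) =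
   \sum_(j < m.+1) (b j + x ^+ j.+1) * P`_(m - j) - x * Q`_m.
  by rewrite -tel -sumrB; apply: eq_bigr => j _; rewrite mulrDl addrK.
by rewrite conv PS mulrnBl mulrnAr [(x * Q`_m) *+ m.+1]mulrS opprD addrA addrAC.
Qed.

Lemma log_deriv_prod M b (s : seq A) Q :
  log_deriv M (fun j => b j + \sum_(x <- s) x ^+ j.+1) Q ->
  log_deriv M b (\prod_(x <- s) (1 - x *: 'X) * Q).
Proof.
elim: s Q => [|x s IHs] Q HQ.
  rewrite big_nil mul1r => m mM; rewrite HQ //.
  by apply: eq_bigr => j _; rewrite big_nil addr0.
rewrite big_cons [_ * \prod_(_ <- _) _]mulrC -mulrA; apply: IHs.
apply: log_deriv_mul => m mM; rewrite HQ //.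
by apply: eq_bigr => j _; rewrite big_cons /= addrA addrAC.
Qed.

End EliminateVariables.

(** * Evaluation at the power sums, shifted in [t_1] *)

Section ShiftedEvaluation.
Variables (C : numClosedFieldType) (k : nat).

Definition cst (c : C) : {poly {mpoly C[k]}} := (c%:MP)%:P.

HB.instance Definition _ := GRing.RMorphism.copy cst (polyC \o @mpolyC k C).

Definition shifted_var (i : nat) : {poly {mpoly C[k]}} :=
  (powsum C k i.+1)%:P + 'X *+ (i == 0%N).

(* The substitution [t_1 := z + sum_i x_i], [t_j := sum_i x_i^j / j] for
   [j > 1], as a polynomial in [z]; its Taylor coefficients at [z = 0] are the
   evaluations of the [t_1]-derivatives. *)
Definition shifted_eval n (p : {mpoly C[n]}) : {poly {mpoly C[k]}} :=
  mmap cst (fun i : 'I_n => shifted_var i) p.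

HB.instance Definition _ n := GRing.RMorphism.copy (@shifted_eval n)
  (mmap cst (fun i : 'I_n => shifted_var i)).

Lemma shifted_evalC n c : shifted_eval (c%:MP : {mpoly C[n]}) = cst c.
Proof. exact: mmapC. Qed.

Lemma shifted_evalX n (i : 'I_n) : shifted_eval 'X_i = shifted_var i.
Proof. by rewrite /shifted_eval mmapX mmap1U. Qed.

(** Chain rule: only the image of [t_1] depends on [z], with derivative 1. Both sides obey the
    Leibniz rule, so constants and variables suffice. *)
Lemma shifted_eval_mderiv n (p : {mpoly C[n.+1]}) :
  shifted_eval (mderiv ord0 p) = (shifted_eval p)^`().
Proof.
pose P (q : {mpoly C[n.+1]}) :=
  shifted_eval (mderiv ord0 q) = (shifted_eval q)^`().
have PM q r : P q -> P r -> P (q * r).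
  by rewrite /P => Pq Pr; rewrite mderivM rmorphD !rmorphM /= Pq Pr derivM.
have PC c : P c%:MP by rewrite /P mderivC rmorph0 shifted_evalC derivC.
have PX i : P 'X_i.
  rewrite /P mderivX shifted_evalX /shifted_var derivD derivC add0r derivMn derivX.
  rewrite mnmE; case: eqVneq => [->|ne] /=.
    have -> : (U_(ord0) - U_(ord0))%MM = 0%MM :> 'X_{1..n.+1}.
      by apply/mnmP=> j; rewrite mnmBE subnn mnm0E.
    by rewrite mpolyX0 scale1r rmorph1.
  rewrite scale0r rmorph0; suff /negbTE-> : val i != 0%N by [].
  exact: ne.
elim/mpolyind: p => [|c m p _ _ IH]; first by rewrite -mpolyC0; apply: PC.
rewrite mderivD !rmorphD /= derivD IH; congr (_ + _).
rewrite -mul_mpolyC -/(P (c%:MP * 'X_[m])); apply: (PM _ _ (PC c)).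
rewrite mpolyXE_id; apply: big_ind => [||i _]; first by rewrite -mpolyC1; apply: PC.
  exact: PM.
elim: (m i) => [|e IHe]; first by rewrite expr0 -mpolyC1; apply: PC.
rewrite exprS; exact: (PM _ _ (PX i) IHe).
Qed.

Lemma coef0_shifted_eval n (p : {mpoly C[n]}) : (shifted_eval p)`_0 = eval_x k p.
Proof.
rewrite /eval_x /comp_mpoly /mmap -horner_coef0 -/(horner_eval 0 _) rmorph_sum.
apply: eq_bigr => m _; rewrite rmorphM /= /horner_eval hornerC; congr (_ * _).
rewrite -/(horner_eval 0 _) rmorph_prod; apply: eq_bigr => i _.
rewrite rmorphXn /= tnth_mktuple /horner_eval /shifted_var.
by rewrite hornerD hornerC hornerMn hornerX mul0rn addr0.
Qed.

Lemma eval_x_iter_mderiv n N (p : {mpoly C[n.+1]}) :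
  eval_x k (iter N (mderiv ord0) p) = (shifted_eval p)`_N *+ N`!.
Proof.
rewrite -coef0_shifted_eval.
have -> : shifted_eval (iter N (mderiv ord0) p) = (shifted_eval p)^`(N).
  elim: N => //= N IHN; by rewrite shifted_eval_mderiv IHN.
by rewrite coef_derivn addn0 ffactnn.
Qed.

Definition inv_fact (z : int) : C := if (z < 0)%R then 0 else (`|z|%N`!%:R)^-1.

(** The coefficient of [u^z] in [exp ('X u)]; at negative [z] the factor [inv_fact] vanishes, so the
    absolute value in the exponent is harmless. *)
Definition exp_coef (z : int) : {poly {mpoly C[k]}} := cst (inv_fact z) * 'X^`|z|%N.

Lemma tvarE n j : (0 < j <= n.+1)%N ->
  shifted_eval (tvar C n j) = shifted_var j.-1.
Proof.
move=> jn; rewrite /tvar jn shifted_evalX inordK //.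
by case/andP: jn; case: j.
Qed.

(** These are the coefficients of the logarithmic derivative of [exp (z u) / prod_i (1 - x_i u)]:
    power sums from the product, [z] from the exponential. *)
Lemma shifted_varMn j : shifted_var j *+ j.+1 =
  \sum_(i < k) ('X_i)%:P ^+ j.+1 + 'X *+ (j == 0%N).
Proof.
rewrite /shifted_var mulrnDl; congr (_ + _); last first.
  by case: j => [|j]; rewrite ?mulr1n // mulr0n mul0rn.
rewrite -polyCMn /powsum -sumrMnl rmorph_sum; apply: eq_bigr => i _.
rewrite -scaler_nat scalerA mulfV ?pnatr_eq0 // scale1r.
by rewrite -rmorphXn.
Qed.

(* [shifted_eval] of [exp (sum_j t_j u^j)] is
   [exp (z u) / prod_i (1 - x_i u)]. *)
Lemma shifted_eval_pfun n m : (m <= n.+1)%N ->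
  (\prod_(i < k) (1 - ('X_i)%:P *: 'X) *
   \poly_(j < n.+2) shifted_eval (pfun (tvar C n) j))`_m = exp_coef m.
Proof.
set Q := \poly_(j < _) _; set P := _ * Q.
have Q0 : Q`_0 = 1 by rewrite coef_poly /= pfun0 rmorph1.
have P0 : P`_0 = 1 by rewrite /P coef0M Q0 mulr1 coef0_prod_1sub.
(* The factors [1 - x_i u] remove the power sums and leave the differential equation of
   [exp (z u)]. *)
have : log_deriv n.+1 (fun j => 'X *+ (j == 0%N)) P.
  have -> : P = \prod_(x <- [seq ('X_i)%:P | i : 'I_k]) (1 - x *: 'X) * Q.
    by rewrite big_map big_enum.
  apply: log_deriv_prod => j jn; rewrite coef_poly ltnS jn -rmorphMn pfun_rec.
  rewrite rmorph_sum; apply: eq_bigr => -[i /=]; rewrite ltnS => ij _.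
  rewrite rmorphM rmorphMn /= tvarE ?shifted_varMn /=; last first.
    exact: leq_ltn_trans jn.
  rewrite big_map big_enum /= [X in X * _]addrC coef_poly ifT //.
  by rewrite ltnS (leq_trans (leq_subr _ _)) // ltnW.
elim: m => [|m IHm] HP mn.
  by rewrite P0 /exp_coef /inv_fact /= fact0 invr1 expr0 mulr1 rmorph1.
(* Only [j = 0] survives: [(m + 1) P_(m+1) = z P_m]. *)
have := HP m mn; rewrite big_ord_recl big1 ?addr0 => [|i _]; last first.
  by rewrite mulr0n mul0r.
rewrite subn0 mulr1n IHm 1?ltnW // => e.
have u : cst (m.+1%:R^-1) * m.+1%:R = 1.
  by rewrite -(rmorph_nat cst) -rmorphM mulVf ?pnatr_eq0 // rmorph1.
rewrite -[LHS]mul1r -u -mulrA mulr_natl e /exp_coef /inv_fact /=.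
rewrite factS natrM invfM rmorphM exprS -!mulrA; congr (_ * _).
by rewrite mulrCA.
Qed.

End ShiftedEvaluation.

(** * Determinants *)

Section Determinants.
Variable R : comNzRingType.

Lemma det_mulmx_unitrig n (M U : 'M[R]_n) :
  (forall i j : 'I_n, (j < i)%N -> U i j = 0) -> (forall i, U i i = 1) ->
  \det (M *m U) = \det M.
Proof.
move=> U0 U1; rewrite det_mulmx -[\det U]det_tr [\det U^T]det_trig; last first.
  by apply/is_trig_mxP=> i j ij; rewrite mxE U0.
by rewrite big1 ?mulr1 // => i _; rewrite mxE U1.
Qed.

(** From column [k] on, each column receives multiples of the [k] columns to its left, all of which
    exist; the constant coefficient 1 of [F] makes this operation unitriangular. *)
Lemma det_convolve_cols k n (q : int -> R) (F : {poly R}) (d : nat -> int) :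
  F`_0 = 1 -> (size F <= k.+1)%N ->
  \det (\matrix_(i < n, j < n) q (d i + j%:Z)) =
  \det (\matrix_(i < n, j < n) if (j < k)%N then q (d i + j%:Z)
          else \sum_(s < k.+1) F`_s * q (d i + j%:Z - s%:Z)).
Proof.
move=> F0 sF; pose U := \matrix_(r < n, j < n)
  if (j < k)%N then (r == j)%:R else if (r <= j)%N then F`_(j - r) else 0.
rewrite -[LHS](@det_mulmx_unitrig _ _ U).
- congr (\det _); apply/matrixP=> i j; rewrite !mxE.
  have [jk|kj] := ltnP j k.
    rewrite (bigD1 j) //= !mxE jk eqxx mulr1 big1 ?addr0 // => r rj.
    by rewrite !mxE jk (negbTE rj) mulr0.
  rewrite (big_ord_widen j.+1 (fun s => F`_s * q (d i + j%:Z - s%:Z))) //.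
  rewrite [RHS]big_mkcond /=.
  (* As [k <= j], extending the sum to [s <= j] only adds coefficients of [F] beyond its size. *)
  transitivity (\sum_(s < j.+1) F`_s * q (d i + j%:Z - s%:Z)); last first.
    apply: eq_bigr => s _; case: ltnP => // ks.
    by rewrite nth_default ?mul0r // (leq_trans sF).
  rewrite [RHS](reindex_inj rev_ord_inj) /=.
  under [RHS]eq_bigr do rewrite subSS.
  rewrite (big_ord_widen n (fun s => F`_(j - s) * q (d i + j%:Z - (j - s)%N%:Z))) //.
  rewrite [RHS]big_mkcond /=; apply: eq_bigr => r _.
  rewrite !mxE ltnNge kj /= ltnS; case: leqP => rj; last by rewrite mulr0.
  by rewrite mulrC -subzn // opprB addrA addrAC addrK.
- move=> i j ji; rewrite mxE [(i <= j)%N]leqNgt ji /=; case: ifP => // _.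
  by rewrite -val_eqE /= gtn_eqF.
- by move=> i; rewrite mxE eqxx leqnn subnn F0; case: ifP.
Qed.

(* After scaling row [k + i] by [X^(a i)], column [k + j] becomes divisible by
   [X^(s j)], and the quotient is block triangular modulo [X]. *)
Lemma coef_det_graded k L (P : 'M[{poly R}]_k) (u : 'M_(k, L)) (W : 'M_(L, k))
    (D : 'M_L) (c : 'M[R]_L) (a s : 'I_L -> nat) S N :
  (forall i j, 'X^(a i) * D i j = (c i j)%:P * 'X^(s j)) ->
  (\sum_i s i = S + \sum_i a i)%N -> (N <= S)%N ->
  (\det (block_mx P (\matrix_(i, j) (u i j * 'X^((s j).+1))) W D))`_N =
  (\det (map_mx (coefp 0) P) * \det c) *+ (N == S).
Proof.
move=> aD sS NS; set M := block_mx _ _ _ _.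
pose DA : 'M[{poly R}]_L := diag_mx (\row_i 'X^(a i)).
pose DS : 'M[{poly R}]_L := diag_mx (\row_i 'X^(s i)).
pose T := block_mx P (\matrix_(i, j) (u i j * 'X)) (DA *m W) (map_mx polyC c).
have E : block_mx 1%:M 0 0 DA *m M = T *m block_mx 1%:M 0 0 DS.
  rewrite !mulmx_block !mul1mx !mul0mx !mulmx0 !mulmx1 !addr0 !add0r.
  congr (block_mx _ _ _ _); apply/matrixP=> i j.
    by rewrite mul_mx_diag !mxE exprS mulrA.
  by rewrite mul_diag_mx mul_mx_diag !mxE aD.
have det_T0 : (\det T)`_0 = \det (map_mx (coefp 0) P) * \det c.
  rewrite -[LHS]/(coefp 0 (\det T)) -det_map_mx /T map_block_mx.
  have -> : map_mx (coefp 0) (\matrix_(i, j) (u i j * 'X)) = 0.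
    by apply/matrixP=> i j; rewrite !mxE /= coefMX.
  rewrite det_lblock; congr (_ * \det _).
  by apply/matrixP=> i j; rewrite !mxE /= coefC.
have det_D (b : 'I_L -> nat) : \det (block_mx 1%:M 0 0
    (diag_mx (\row_i 'X^(b i)))) = 'X^(\sum_i b i) :> {poly R}.
  rewrite det_lblock det1 mul1r det_diag expr_sum.
  by apply: eq_bigr => i _; rewrite mxE.
(* Determinants in [E] give [X^(sum a) det M = X^(sum s) det T]; reading the coefficient of degree
   [N + sum a] avoids dividing by a power of [X]. *)
have := congr1 (fun B : 'M[{poly R}]_(k + L) => (\det B)`_(N + \sum_i a i)) E.
rewrite /= !det_mulmx !det_D coefXnM ltnNge leq_addl /= addnK => ->.
rewrite sS coefMXn ltn_add2r; case: ltngtP NS => // -> _.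
by rewrite subnn det_T0.
Qed.

(** Rows and columns undergo the same permutation, so its sign occurs twice. This matches the
    numbering of [wi], which starts from the last part. *)
Lemma det_reindex_rev n (M : 'M[R]_n) :
  \det (\matrix_(i, j) M (rev_ord i) (rev_ord j)) = \det M.
Proof.
pose s := perm (@rev_ord_inj n).
have -> : \matrix_(i, j) M (rev_ord i) (rev_ord j) = row_perm s (col_perm s M).
  by apply/matrixP=> i j; rewrite !mxE !permE.
rewrite row_permE col_permE !det_mulmx !det_perm odd_permV mulrCA mulrA.
by rewrite -mulrA -signr_addb addbb mulr1.
Qed.

Lemma horner_ffact (n d : nat) :
  (\prod_(e < d) ('X - (e%:R)%:P)).[n%:R] = (n ^_ d)%:R :> R.
Proof.
elim: d => [|d IHd]; first by rewrite big_ord0 hornerC.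
rewrite big_ord_recr hornerM IHd hornerXsubC ffactnSr natrM.
have [dn|nd] := leqP d n; first by rewrite natrB.
by rewrite ffact_small // !mul0r.
Qed.

(** The falling factorial of order [j] is a monic polynomial of degree [j] in [w i], so the matrix
    is a Vandermonde matrix times a unitriangular one. *)
Lemma det_ffact L (w : nat -> nat) :
  \det (\matrix_(i < L, j < L) (w i ^_ j)%:R) =
  \prod_(i < L) \prod_(j < L | (i < j)%N) ((w j)%:R - (w i)%:R) :> R.
Proof.
pose ff d : {poly R} := \prod_(e < d) ('X - (e%:R)%:P).
have sff d : size (ff d) = d.+1.
  by rewrite /ff size_prod_XsubC /index_enum -enumT size_enum_ord.
pose V := Vandermonde L (\row_(i < L) (w i)%:R : 'rV[R]_L).
rewrite -[RHS](_ : \det V = _); last first.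
  rewrite det_Vandermonde; apply: eq_bigr => i _; apply: eq_bigr => j _.
  by rewrite !mxE.
rewrite -[\det V]det_tr -(@det_mulmx_unitrig _ V^T (\matrix_(e, d) (ff d)`_e)).
- congr (\det _); apply/matrixP=> i d; rewrite !mxE -horner_ffact -/(ff d).
  rewrite (horner_coef_wide _ (_ : size (ff d) <= L)%N) ?sff //.
  by apply: eq_bigr => e _; rewrite !mxE mulrC.
- by move=> e d de; rewrite mxE nth_default ?sff.
- move=> e; rewrite mxE.
  have /monicP := monic_prod_XsubC (index_enum 'I_e) xpredT
    (fun i : 'I_e => (i : nat)%:R : R).
  by rewrite lead_coefE sff.
Qed.

End Determinants.

Lemma inv_factB (C : numClosedFieldType) (w d : nat) :
  inv_fact C (w%:Z - d%:Z) = (w ^_ d)%:R / (w`!)%:R.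
Proof.
rewrite /inv_fact; have [dw|wd] := leqP d w.
  rewrite subzn //= -(ffact_fact dw) natrM invfM mulrA mulfV ?mul1r //.
  by rewrite pnatr_eq0 -lt0n ffact_gt0.
by rewrite subr_lt0 ltz_nat wd ffact_small // mul0r.
Qed.

(** Pulling [1 / (w i)!] out of each row leaves falling factorials. *)
Lemma det_inv_fact (C : numClosedFieldType) L (w : nat -> nat) :
  \det (\matrix_(i < L, j < L) inv_fact C ((w i)%:Z - j%:Z)) =
  (\prod_(i < L) ((w i)`!)%:R)^-1 *
  \prod_(i < L) \prod_(j < L | (i < j)%N) ((w j)%:R - (w i)%:R).
Proof.
rewrite -det_ffact -prodfV -[X in X * _](_ :
  \det (diag_mx (\row_(i < L) ((w i)`!%:R)^-1)) = _); last first.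
  by rewrite det_diag; apply: eq_bigr => i _; rewrite mxE.
rewrite -det_mulmx; congr (\det _); apply/matrixP=> i j.
by rewrite mul_diag_mx !mxE inv_factB mulrC.
Qed.

(** * Schur functions *)

Lemma is_part_nth_leq mu i j : is_part mu -> (i <= j)%N ->
  (nth 0%N mu j <= nth 0%N mu i)%N.
Proof.
case/andP=> smu _ ij; have [jn|nj] := ltnP j (size mu); last by rewrite nth_default.
have geq_trans : transitive geq by move=> a b c /= ba cb; exact: leq_trans cb ba.
have := sorted_leq_nth geq_trans leqnn 0%N smu; apply => //.
by rewrite inE (leq_ltn_trans ij).
Qed.

Lemma is_part_take mu K : is_part mu -> is_part (take K mu).
Proof.
case/andP=> smu mu0; rewrite /is_part take_sorted //=.
by apply: contra mu0; apply: mem_take.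
Qed.

(** The bound is the number of variables of [schur_t]: no entry reaches an index where [tvar] is cut
    off to 0. *)
Lemma schur_index_bound mu i j : is_part mu -> (j < size mu)%N ->
  (nth 0%N mu i)%:Z + j%:Z - i%:Z <= (head 0%N mu + size mu).+1%:Z.
Proof.
by move=> pmu; have := is_part_nth_leq pmu (leq0n i); rewrite nth0; lia.
Qed.

Lemma det_matrix_size (R : comNzRingType) n n' (E : nat -> nat -> R) : n = n' ->
  \det (\matrix_(i < n, j < n) E i j) = \det (\matrix_(i < n', j < n') E i j).
Proof. by move->. Qed.

Lemma rmorph_det_matrix (R S : comNzRingType) (f : {rmorphism R -> S}) n
    (E : nat -> nat -> R) :
  f (\det (\matrix_(i < n, j < n) E i j)) = \det (\matrix_(i < n, j < n) f (E i j)).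
Proof. by rewrite -det_map_mx; congr (\det _); apply/matrixP=> i j; rewrite !mxE. Qed.

Lemma matrix_block (R : Type) k L (E : nat -> nat -> R) :
  \matrix_(i < k + L, j < k + L) E i j =
  block_mx (\matrix_(i, j) E i j) (\matrix_(i, j) E i (k + j)%N)
           (\matrix_(i, j) E (k + i)%N j) (\matrix_(i, j) E (k + i)%N (k + j)%N).
Proof.
apply/matrixP=> i j; rewrite !mxE.
by case: splitP => i' ->; rewrite !mxE; case: splitP => j' ->; rewrite mxE.
Qed.

Lemma eq_det_matrix (R : comNzRingType) n (E E' : nat -> nat -> R) :
  (forall i j, (i < n)%N -> (j < n)%N -> E i j = E' i j) ->
  \det (\matrix_(i < n, j < n) E i j) = \det (\matrix_(i < n, j < n) E' i j).
Proof. by move=> eqE; congr (\det _); apply/matrixP=> i j; rewrite !mxE eqE. Qed.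

(** The determinant argument over any ring: [q] stands for the shifted complete functions, [F] for
    [prod_i (1 - x_i u)] and [e] for the inverse factorials. *)
Lemma coef_det_partition (R : comNzRingType) k mu (F : {poly {poly R}})
    (q : int -> {poly R}) (e : int -> R) N :
  is_part mu -> (k <= size mu)%N -> (N <= sumn (drop k mu))%N ->
  F`_0 = 1 -> (size F <= k.+1)%N -> (forall z : int, z < 0 -> e z = 0) ->
  (forall z : int, z <= (head 0%N mu + size mu).+1%:Z ->
    \sum_(s < k.+1) F`_s * q (z - s%:Z) = (e z)%:P * 'X^`|z|%N) ->
  (\det (\matrix_(i < size mu, j < size mu)
     q ((nth 0%N mu i)%:Z + j%:Z - i%:Z)))`_N =
  (\det (\matrix_(i < k, j < k) (q ((nth 0%N mu i)%:Z + j%:Z - i%:Z))`_0) *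
   \det (\matrix_(i < size mu - k, j < size mu - k)
      e ((nth 0%N mu (k + i))%:Z - i%:Z + j%:Z)))
  *+ (N == sumn (drop k mu)).
Proof.
move=> pmu kmu NS F0 sF e0 Fq.
pose d i : int := (nth 0%N mu i)%:Z - i%:Z.
pose E i j := if (j < k)%N then q (d i + j%:Z)
  else (e (d i + j%:Z))%:P * 'X^`|(d i + j%:Z)%R|%N.
have -> : \det (\matrix_(i < size mu, j < size mu)
     q ((nth 0%N mu i)%:Z + j%:Z - i%:Z)) =
    \det (\matrix_(i < size mu, j < size mu) E i j).
  transitivity (\det (\matrix_(i < size mu, j < size mu) q (d i + j%:Z))).
    by congr (\det _); apply/matrixP=> i j; rewrite !mxE /d addrAC.
  rewrite (@det_convolve_cols _ k _ q F d) //.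
  congr (\det _); apply/matrixP=> i j; rewrite !mxE /E; case: ifP => // _.
  by rewrite Fq // /d addrAC; exact: (schur_index_bound i pmu (ltn_ord j)).
pose L := (size mu - k)%N; have Ln : size mu = (k + L)%N by rewrite subnKC.
rewrite (det_matrix_size E Ln) matrix_block.
(* The part [mk] bounds all later ones, so [a] involves no truncated subtraction. Lower right
   entries have degree [s j - a i]; upper right ones come from parts at least [mk] in rows above
   [k], hence have degree greater than [s j]. *)
pose mk := nth 0%N mu k.
pose s (j : 'I_L) := (mk + j)%N.
pose a (i : 'I_L) := (mk - nth 0%N mu (k + i) + i)%N.
pose c := (\matrix_(i < L, j < L) e ((nth 0%N mu (k + i))%:Z - i%:Z + j%:Z)).
pose u := \matrix_(i < k, j < L) ((e (d i + (k + j)%N%:Z))%:P *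
      'X^(nth 0%N mu i - mk + (k - i).-1)).
have mu_le i : (nth 0%N mu (k + i) <= mk)%N by exact/is_part_nth_leq/leq_addr.
have Ssum : sumn (drop k mu) = (\sum_(i < L) nth 0%N mu (k + i))%N.
  rewrite sumnE (big_nth 0%N) size_drop big_mkord.
  by apply: eq_bigr => i _; rewrite nth_drop.
rewrite [X in block_mx _ X](_ : _ = \matrix_(i, j) (u i j * 'X^((s j).+1))); last first.
  apply/matrixP=> i j; rewrite !mxE /E ltnNge leq_addr /= -mulrA.
  rewrite -exprD; congr (_ * 'X^_).
  have := is_part_nth_leq pmu (ltnW (ltn_ord i)); rewrite -/mk /d /s.
  by have := ltn_ord i; lia.
rewrite (@coef_det_graded _ _ _ _ _ _ _ c a s (sumn (drop k mu))) //.
- congr (\det _ * _ *+ _); apply/matrixP=> i j; rewrite !mxE /=.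
  by rewrite /E ltn_ord /d addrAC.
- move=> i j; rewrite !mxE /E ltnNge leq_addr /=.
  have -> : d (k + i)%N + (k + j)%N%:Z = (nth 0%N mu (k + i))%:Z - i%:Z + j%:Z.
    by rewrite /d; lia.
  rewrite mulrCA -exprD; set z := _ + _.
  (* For a negative exponent the absolute value is wrong, but then [e] vanishes. *)
  have [z0|z0] := ltrP z 0; first by rewrite e0 // polyC0 !mul0r.
  congr (_ * 'X^_); move: z0; rewrite /z /a /s; have := mu_le i; lia.
rewrite Ssum -big_split /=; apply: eq_bigr => i _; rewrite /s /a.
have := mu_le i; lia.
Qed.

(** * Low Taylor coefficients of evaluated Schur functions *)

Section SchurCoefficient.
Variables (C : numClosedFieldType) (k : nat).

Lemma conv_shifted_eval n z : (z <= n.+1%:Z)%R ->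
  \sum_(s < k.+1) (\prod_(i < k) (1 - ('X_i)%:P *: 'X))`_s *
    shifted_eval k (pfunz (tvar C n) (z - s%:Z)) = exp_coef C k z.
Proof.
set F := \prod_(i < k) _; case: z => [m|m] mn; last first.
  rewrite /exp_coef /inv_fact /= rmorph0 mul0r big1 // => s _.
  by rewrite /pfunz ifT ?rmorph0 ?mulr0 // NegzE -opprD oppr_lt0.
rewrite -(@shifted_eval_pfun C k n m) // -/F coefM.
pose G s := F`_s * shifted_eval k (pfunz (tvar C n) (m%:Z - s%:Z)).
have sF : (size F <= k.+1)%N by exact: size_prod_1sub.
(* Both sums extend to [s <= k + m]: beyond [k] the coefficients of [F] vanish, beyond [m] the index
   of [pfunz] is negative. *)
transitivity (\sum_(s < (k + m).+1) G s).
  rewrite (big_ord_widen (k + m).+1 G) ?ltnS ?leq_addr // big_mkcond /=.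
  apply: eq_bigr => s _; case: ltnP => // ks.
  by rewrite /G nth_default ?mul0r // (leq_trans sF).
rewrite [RHS](eq_bigr (fun s : 'I__ => G s)) => [|[s /=]]; last first.
  rewrite ltnS => sm _; rewrite /G subzn // /pfunz /= coef_poly ifT //.
  by rewrite ltnS (leq_trans (leq_subr _ _)) // ltnW.
rewrite [RHS](big_ord_widen (k + m).+1 G) ?ltnS ?leq_addl // [RHS]big_mkcond /=.
apply: eq_bigr => s _; case: ltnP => // ms.
by rewrite /G /pfunz ifT ?rmorph0 ?mulr0 // subr_lt0.
Qed.

(** Both families satisfy [pfun_rec], which determines them because [m.+1] is invertible in [C]. *)
Lemma eval_x_pfun n m : (m <= n.+1)%N ->
  eval_x k (pfun (tvar C n) m) = pfun (powsum C k) m.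
Proof.
elim/ltn_ind: m => -[|m] IHm mn; first by rewrite !pfun0 /eval_x comp_mpoly1.
apply: (scalerI (_ : (m.+1%:R : C) != 0)); first by rewrite pnatr_eq0.
rewrite !scaler_nat /eval_x -rmorphMn !pfun_rec rmorph_sum.
apply: eq_bigr => -[i /=]; rewrite ltnS => im _.
rewrite rmorphM rmorphMn /= -!/(eval_x k _) IHm ?ltnS ?leq_subr //; last first.
  by rewrite (leq_trans (leq_subr _ _)) // ltnW.
congr (_ *+ _ * _); have iN : (i < n.+1)%N by exact: leq_ltn_trans mn.
rewrite /tvar /= iN /eval_x comp_mpolyXU -tnth_nth tnth_mktuple inordK //.
Qed.

Lemma eval_x_pfunz n z : (z <= n.+1%:Z)%R ->
  eval_x k (pfunz (tvar C n) z) = pfunz (powsum C k) z.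
Proof.
by case: z => [m|m] mn; rewrite /pfunz /= ?eval_x_pfun // /eval_x comp_mpoly0.
Qed.

(** After evaluation the entries no longer depend on how many variables [schur_t] has, so the
    truncated partition yields a leading minor for [mu]. *)
Lemma eval_x_schur mu K : is_part mu -> (K <= size mu)%N ->
  eval_x k (schur_t C (take K mu)) =
  \det (\matrix_(i < K, j < K) pfunz (powsum C k)
     ((nth 0%N mu i)%:Z - i%:Z + j%:Z)).
Proof.
move=> pmu Kmu; rewrite /schur_t /eval_x -det_map_mx.
have sK : size (take K mu) = K by rewrite size_takel.
rewrite -(@det_matrix_size _ _ _ (fun i j => pfunz (powsum C k)
     ((nth 0%N mu i)%:Z - i%:Z + j%:Z)) sK).
congr (\det _); apply/matrixP=> i j; rewrite !mxE.
apply: etrans (eval_x_pfunz _) _; first by rewrite schur_index_bound ?is_part_take.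
have iK : (i < K)%N by rewrite -[X in (_ < X)%N]sK; apply: ltn_ord.
by rewrite nth_take // addrAC.
Qed.

Lemma shifted_eval_det n m (E : nat -> nat -> {mpoly C[n]}) :
  shifted_eval k (\det (\matrix_(i < m, j < m) E i j)) = \det (\matrix_(i < m, j < m)
    shifted_eval k (E i j)).
Proof. exact: rmorph_det_matrix. Qed.

Lemma shifted_eval_schur mu :
  shifted_eval k (schur_t C mu) = \det (\matrix_(i < size mu, j < size mu)
    shifted_eval k (pfunz (tvar C (head 0%N mu + size mu))
      ((nth 0%N mu i)%:Z + j%:Z - i%:Z))).
Proof.
exact: (shifted_eval_det (size mu) (fun i j => pfunz (tvar C (head 0%N mu + size mu))
      ((nth 0%N mu i)%:Z + j%:Z - i%:Z))).
Qed.

Lemma coef_shifted_eval_schur mu N : is_part mu -> (k <= size mu)%N ->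
  (N <= sumn (drop k mu))%N ->
  (shifted_eval k (schur_t C mu))`_N =
  (eval_x k (schur_t C (take k mu)) *
   (\det (\matrix_(i < size mu - k, j < size mu - k)
      inv_fact C ((nth 0%N mu (k + i))%:Z - i%:Z + j%:Z)))%:MP)
  *+ (N == sumn (drop k mu)).
Proof.
move=> pmu kmu NS; rewrite shifted_eval_schur.
rewrite (@coef_det_partition _ k mu (\prod_(i < k) (1 - ('X_i)%:P *: 'X))
  (fun z => shifted_eval k (pfunz (tvar C (head 0%N mu + size mu)) z))
  (fun z => (inv_fact C z)%:MP)) //.
- congr (_ * _ *+ _); last first.
    by rewrite (@rmorph_det_matrix _ _ (@mpolyC k C) _ (fun i j =>
      inv_fact C ((nth 0%N mu (k + i))%:Z - i%:Z + j%:Z))).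
  rewrite eval_x_schur //.
  apply: (@eq_det_matrix _ k
    (fun i j => (shifted_eval k (pfunz (tvar C (head 0%N mu + size mu))
       ((nth 0%N mu i)%:Z + j%:Z - i%:Z)))`_0)
    (fun i j => pfunz (powsum C k) ((nth 0%N mu i)%:Z - i%:Z + j%:Z))) => i j ik jk.
  rewrite coef0_shifted_eval eval_x_pfunz; first by rewrite addrAC.
  exact: (schur_index_bound i pmu (leq_trans jk kmu)).
- exact: coef0_prod_1sub.
- exact: size_prod_1sub.
- by move=> z z0; rewrite /inv_fact z0 mpolyC0.
- by move=> z zn; exact: conv_shifted_eval.
Qed.

End SchurCoefficient.

(** * Containment of partitions and comparison of tails *)

Section Partitions.
Implicit Types lam mu : seq nat.

Lemma is_part_nth_gt0 mu i : is_part mu -> (0 < nth 0%N mu i)%N = (i < size mu)%N.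
Proof.
case/andP=> _ mu0; have [im|mi] := ltnP i (size mu); last by rewrite nth_default.
by rewrite lt0n; apply: contraNneq mu0 => <-; apply: mem_nth.
Qed.

Lemma part_leq_nth lam mu i : part_leq lam mu -> (nth 0%N lam i <= nth 0%N mu i)%N.
Proof.
move/allP=> lm; have [il|li] := ltnP i (size lam); last by rewrite nth_default.
by apply: lm; rewrite mem_iota.
Qed.

Lemma part_leq_size lam mu : is_part lam -> is_part mu -> part_leq lam mu ->
  (size lam <= size mu)%N.
Proof.
move=> pl pm lm; case: (posnP (size lam)) => [->//|l0].
rewrite -(prednK l0) -is_part_nth_gt0 // (leq_trans _ (part_leq_nth _ lm)) //.
by rewrite is_part_nth_gt0 // prednK.
Qed.

Lemma sumn_nth n (s : seq nat) : (size s <= n)%N ->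
  sumn s = (\sum_(i < n) nth 0%N s i)%N.
Proof.
move=> sn; rewrite sumnE (big_nth 0%N) big_mkord.
rewrite (big_ord_widen n (fun i => nth 0%N s i)) // big_mkcond /=.
by apply: eq_bigr => i _; case: ltnP => // si; rewrite nth_default.
Qed.

(** Parts compare one by one, so equal sums force equal parts; equal lengths follow because parts
    are positive while missing ones read as 0. *)
Lemma Nlk_leqif lam mu k : is_part lam -> is_part mu -> part_leq lam mu ->
  (k <= size lam)%N ->
  (Nlk lam k <= sumn (drop k mu) ?= iff (drop k mu == drop k lam))%N.
Proof.
move=> pl pm lm kl; have sz := part_leq_size pl pm lm.
set n := size (drop k mu).
have le_nth i : (nth 0%N (drop k lam) i <= nth 0%N (drop k mu) i)%N.
  by rewrite !nth_drop part_leq_nth.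
have sdl : (size (drop k lam) <= n)%N by rewrite /n !size_drop leq_sub2r.
have [|le_sum eq_sum] := @leqif_sum 'I_n xpredT
  (fun i => nth 0%N (drop k lam) i == nth 0%N (drop k mu) i)
  (fun i => nth 0%N (drop k lam) i) (fun i => nth 0%N (drop k mu) i).
  by move=> i _; split=> //; apply: le_nth.
rewrite /Nlk (sumn_nth sdl) (sumn_nth (leqnn n)); split; first exact: le_sum.
rewrite eq_sum; apply/forallP/eqP=> [eq_nth|-> i]; last by rewrite eqxx.
have eq_size : size (drop k mu) = size (drop k lam).
  apply/eqP; rewrite eqn_leq sdl andbT leqNgt; apply/negP=> lt_size.
  have := eqP (eq_nth (Ordinal lt_size)) => /=; rewrite nth_default // nth_drop.
  move/esym/eqP; rewrite -[_ == _]negbK -lt0n is_part_nth_gt0 //.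
  by move: lt_size; rewrite /n !size_drop; lia.
apply: (@eq_from_nth _ 0%N) => // i im.
by rewrite (eqP (eq_nth (Ordinal im))).
Qed.

Lemma is_part_of_ffun D (f : {ffun 'I_D -> 'I_D.+1}) :
  ffun_noninc f -> is_part (part_of_ffun f).
Proof.
move=> /forallP noninc; apply/andP; split; last first.
  by apply/mapP=> -[i]; rewrite mem_filter => /andP[+ _] => /[swap] <-.
rewrite /part_of_ffun sorted_map; apply: sorted_filter.
  by move=> i j l /= ji il; exact: leq_trans il ji.
apply: (@sub_sorted _ (fun i j : 'I_D => i <= j)%N).
  by move=> i j /= ij; exact: (implyP (forallP (noninc i) j)).
by rewrite -(@sorted_map _ _ val leq) val_enum_ord iota_sorted.
Qed.

End Partitions.

(** * The constant and the identity for each partition *)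

Lemma cprimeE (C : numClosedFieldType) lam k : (k <= size lam)%N ->
  cprime C lam k = (Nlk lam k)`!%:R *
    \det (\matrix_(i < size lam - k, j < size lam - k)
      inv_fact C ((nth 0%N lam (k + i))%:Z - i%:Z + j%:Z)).
Proof.
(* Reversing rows and columns turns the argument of [inv_fact] into [wi lam i.+1 - j]. *)
move=> kl; rewrite -det_reindex_rev /cprime -mulrA; congr (_ * _).
rewrite -(@det_inv_fact C _ (fun i => wi lam i.+1)).
congr (\det _); apply/matrixP=> i j; rewrite !mxE /wi /=; congr (inv_fact C _).
have -> : (k + (size lam - k - i.+1) = size lam - i.+1)%N.
  by have := ltn_ord i; lia.
by have := ltn_ord i; have := ltn_ord j; lia.
Qed.

(** If the tails of [mu] and [lam] differ, the order in [z] exceeds [Nlk lam k] and the derivative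
    vanishes at [z = 0]. *)
Lemma eval_x_iter_d1_schur (C : numClosedFieldType) lam mu k :
  is_part lam -> is_part mu -> part_leq lam mu -> (k <= size lam)%N ->
  eval_x k (iter (Nlk lam k) (@d1 C mu) (schur_t C mu)) =
  (cprime C lam k *: eval_x k (schur_t C (take k mu)))
    *+ (drop k mu == drop k lam).
Proof.
move=> pl pm lm kl; have [N_le N_eq] := Nlk_leqif pl pm lm kl.
have km := leq_trans kl (part_leq_size pl pm lm).
rewrite (eval_x_iter_mderiv k (Nlk lam k) (schur_t C mu)).
rewrite coef_shifted_eval_schur // N_eq.
case: eqP => [eq_drop|_]; last by rewrite !mulr0n mul0rn.
have eq_size : size mu = size lam.
  by have := congr1 (@size nat) eq_drop; rewrite !size_drop; lia.
rewrite !mulr1n cprimeE // [_ * _%:MP]mulrC mul_mpolyC -scaler_nat scalerA.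
congr (_ * _ *: _).
rewrite eq_size; congr (\det _); apply/matrixP=> i j; rewrite !mxE.
by rewrite -!nth_drop eq_drop.
Qed.

Theorem theorem3p2 (C : numClosedFieldType) (lam : seq nat) (xi : seq nat -> C)
  (k : nat) :
  is_part lam -> (k <= size lam)%N ->
  forall m : 'X_{1..k},
    fps_coef (Nlk lam k) (tau_coef lam xi)
      (fun mu => eval_x k (iter (Nlk lam k) (@d1 C mu) (schur_t C mu))) m
    = cprime C lam k *
      fps_coef (Nlk lam k) (tauk_coef lam xi k)
        (fun mu => eval_x k (schur_t C (take k mu))) m.
Proof.
move=> pl kl m; rewrite /fps_coef /sum_parts_upto mulr_sumr.
(* Both sums run over the same finite set of partitions; the terms that vanish on the left by a
   differing tail are those omitted by [tauk_coef]. *)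
apply: eq_bigr => f /andP[/is_part_of_ffun pm _].
move: (part_of_ffun f) pm => mu pm; rewrite /tau_coef /tauk_coef.
have leq_coef : part_leq lam mu -> 
    (eval_x k (iter (Nlk lam k) (@d1 C mu) (schur_t C mu)))@_m =
    (cprime C lam k * (eval_x k (schur_t C (take k mu)))@_m)
      *+ (drop k mu == drop k lam).
  by move=> lm; rewrite eval_x_iter_d1_schur // mcoeffMn mcoeffZ.
case: eqVneq => [eq_mu|_].
  have /leq_coef-> : part_leq lam mu by rewrite eq_mu; apply/allP=> i _; apply: leqnn.
  by rewrite eq_mu eqxx mulr1n mulrCA.
have [lt_mu|_] := boolP (part_lt lam mu); last by rewrite !mul0r mulr0.
have lm : part_leq lam mu by case/andP: lt_mu.
rewrite leq_coef //=; case: eqP => [eq_drop|_]; last first.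
  by rewrite andbF mulr0n mul0r !mulr0.
(* Equal tails give equal lengths, since both partitions have at least [k] parts. *)
have -> : size mu == size lam.
  have := congr1 (@size nat) eq_drop; rewrite !size_drop.
  by have := part_leq_size pl pm lm; lia.
by rewrite mulr1n mulrCA.
Qed.
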